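(* Let $2<\alpha<3$, $0<\varepsilon\le\frac12$, and let $\gamma\in C^\infty(\mathbb R/\mathbb Z,\mathbb R^n)$ be a simple closed curve parametrized by arc length. There is an analytic function $G_2^\alpha:(\mathbb R^n\setminus\{0,1\})\times\mathbb R^{4n}\to\mathbb R^n$ (independent of $\gamma$ and $\varepsilon$), such that for all $x\in\mathbb R/\mathbb Z$, $$(P^\perp_{\dot\gamma}R_2^{\alpha,\varepsilon}\gamma)(x)=\int_{|w|\in[\varepsilon,\frac12]}\iiiint_{[0,1]^4}(s_1-s_2)^2\,G_2^\alpha\Big(\int_0^1\dot\gamma(x+tw)\,\mathrm dt,\ \dot\gamma(x),\ \ddot\gamma(x+s_2w+(s_1-s_2)\phi_1w),\ \ddot\gamma(x+s_2w+(s_1-s_2)\phi_2w),\ \ddot\gamma(x)\Big)\,\mathrm d\phi_1\,\mathrm d\phi_2\,\mathrm ds_1\,\mathrm ds_2\,\frac{\mathrm dw}{|w|^{\alpha-2}}.$$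
   Context: $(R_2^{\alpha,\varepsilon}\gamma)(x)=\int_{|w|\in[\varepsilon,\frac12]}\ddot\gamma(x)\Big(\frac{1}{|\gamma(x+w)-\gamma(x)|^\alpha}-\frac{1}{|w|^\alpha}\Big)\mathrm dw$. For $v\in\mathbb R^n$, $P^\perp_{\dot\gamma(x)}v=v-\langle v,\dot\gamma(x)\rangle\dot\gamma(x)$ and $(P^\perp_{\dot\gamma}u)(x)=P^\perp_{\dot\gamma(x)}u(x)$. Here ''$\mathbb R^n\setminus\{0,1\}$'' means the first argument $a$ avoids $|a|\in\{0,1\}$ (the function involves $g(a)=\frac{1}{2|a|^\alpha}\frac{1-|a|^\alpha}{1-|a|^2}$). *)

(* Defs.v *)
From Stdlib Require Import Reals ClassicalEpsilon.
From mathcomp Require Import all_boot.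
Set Implicit Arguments. Unset Strict Implicit. Unset Printing Implicit Defensive.
Open Scope R_scope.

Definition vec (n : nat) := 'I_n -> R.
Definition dotv (n : nat) (u v : vec n) : R := \big[Rplus/0]_(i < n) (u i * v i).
Definition normv (n : nat) (u : vec n) : R := sqrt (dotv u u).

(* Total Riemann integral: the Riemann integral of f over [a,b] when f is
   Riemann integrable there (arbitrary value otherwise). *)
Definition Rint (f : R -> R) (a b : R) : R :=
  epsilon (inhabits 0)
    (fun I => exists pr : Riemann_integrable f a b, RiemannInt pr = I).

Definition Rint_ann (f : R -> R) (eps : R) : R :=
  Rint f (- (1/2)) (- eps) + Rint f eps (1/2).

Definition smooth (f : R -> R) : Prop :=
  exists D : nat -> R -> R, D 0%nat = f /\
    forall (k : nat) (x : R), derivable_pt_lim (D k) x (D (S k) x).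

(* Real analyticity of F : R^T -> R on D (T a finite index set of variables):
   near each point of D, F is the sum of an absolutely convergent
   multivariate power series (summed by total degree). *)
Definition mono_term (T : finType) (c : (T -> nat) -> R) (p x : T -> R)
  (d : nat) (k : {ffun T -> 'I_d.+1}) : R :=
  c (fun j => nat_of_ord (k j)) * \big[Rmult/1]_(j : T) ((x j - p j) ^ (k j)).

Definition deg_block (T : finType) (c : (T -> nat) -> R) (p x : T -> R) (d : nat) : R :=
  \big[Rplus/0]_(k : {ffun T -> 'I_d.+1} | (\sum_(j : T) nat_of_ord (k j) == d)%N)
     mono_term c p x k.

Definition deg_block_abs (T : finType) (c : (T -> nat) -> R) (p x : T -> R) (d : nat) : R :=
  \big[Rplus/0]_(k : {ffun T -> 'I_d.+1} | (\sum_(j : T) nat_of_ord (k j) == d)%N)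
     Rabs (mono_term c p x k).

Definition analytic_on (T : finType) (D : (T -> R) -> Prop) (F : (T -> R) -> R) : Prop :=
  forall p, D p -> exists r, 0 < r /\ exists c : (T -> nat) -> R,
    forall x, (forall j, Rabs (x j - p j) < r) ->
      (exists l, Un_cv (fun N => sum_f_R0 (deg_block_abs c p x) N) l) /\
      Un_cv (fun N => sum_f_R0 (deg_block c p x) N) (F x).

Definition blk (n : nat) (z : 'I_5 * 'I_n -> R) (j : 'I_5) : vec n := fun i => z (j, i).
Definition o5_0 : 'I_5 := @Ordinal 5 0 isT.
Definition o5_1 : 'I_5 := @Ordinal 5 1 isT.
Definition o5_2 : 'I_5 := @Ordinal 5 2 isT.
Definition o5_3 : 'I_5 := @Ordinal 5 3 isT.
Definition o5_4 : 'I_5 := @Ordinal 5 4 isT.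

Definition G_domain (n : nat) (z : 'I_5 * 'I_n -> R) : Prop :=
  normv (blk z o5_0) <> 0 /\ normv (blk z o5_0) <> 1.

Definition G_analytic (n : nat)
  (G : vec n -> vec n -> vec n -> vec n -> vec n -> vec n) : Prop :=
  forall i : 'I_n, analytic_on (@G_domain n)
    (fun z => G (blk z o5_0) (blk z o5_1) (blk z o5_2) (blk z o5_3) (blk z o5_4) i).

Definition Pperp (n : nat) (t v : vec n) : vec n := fun i => v i - dotv v t * t i.

Definition R2 (n : nat) (alpha eps : R) (g gdd : R -> vec n) (x : R) : vec n :=
  fun i => Rint_ann (fun w =>
    gdd x i * (/ Rpower (normv (fun j => g (x + w) j - g x j)) alpha
               - / Rpower (Rabs w) alpha)) eps.

Definition avg_vel (n : nat) (gd : R -> vec n) (x w : R) : vec n :=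
  fun i => Rint (fun t => gd (x + t * w) i) 0 1.

Definition RHS6p1 (n : nat) (alpha eps : R)
  (G : vec n -> vec n -> vec n -> vec n -> vec n -> vec n)
  (gd gdd : R -> vec n) (x : R) : vec n :=
  fun i => Rint_ann (fun w =>
    Rint (fun s2 => Rint (fun s1 => Rint (fun p2 => Rint (fun p1 =>
      (s1 - s2) ^ 2 *
      G (avg_vel gd x w) (gd x)
        (gdd (x + s2 * w + (s1 - s2) * p1 * w))
        (gdd (x + s2 * w + (s1 - s2) * p2 * w))
        (gdd x) i) 0 1) 0 1) 0 1) 0 1
    / Rpower (Rabs w) (alpha - 2)) eps.

(* Main.v *)
(* Write [a] for the mean of the velocity over [x, x + w], so that
   [|g (x + w) - g x| = |w| |a|].  The kernel of [R2] is then
   [|w|^-alpha (|a|^-alpha - 1)], and [|a|^-alpha - 1] is [2 (1 - |a|^2)] times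
   the factor [g(a)], while [1 - |a|^2] is half of the double integral of
   [|gd (x + s1 w) - gd (x + s2 w)|^2] because [gd] has unit length.
   Expressing these differences by [gdd] gives the identity with
   [G (a, b, c, d, e) = g(a) <c, d> (e - <e, b> b)].
   Analyticity of [G] reduces to that of [exp], [ln] and [1 / t]: a power series
   is handled through its homogeneous blocks [H d], whose coefficients have
   absolute sum at most [C K^d], and this class is closed under products and
   under composition with one-variable power series. *)
Require Import Defs.
From HB Require Import structures.
From Stdlib Require Import Reals Lra Psatz FunctionalExtensionality ClassicalEpsilon.
From Coquelicot Require Import Coquelicot.
From mathcomp Require Import all_boot.
Set Implicit Arguments. Unset Strict Implicit. Unset Printing Implicit Defensive.
Open Scope R_scope.

(** * Real addition and multiplication as monoids for iterated sums and products *)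

Lemma Rplus_associative : associative Rplus. Proof. move=> x y z; ring. Qed.
Lemma Rmult_associative : associative Rmult. Proof. move=> x y z; ring. Qed.
HB.instance Definition _ := Monoid.isComLaw.Build R 0 Rplus Rplus_associative Rplus_comm Rplus_0_l.
HB.instance Definition _ := Monoid.isComLaw.Build R 1 Rmult Rmult_associative Rmult_comm Rmult_1_l.
(** * Power series by homogeneous blocks *)

Lemma sumR_ge0 (I : Type) (s : seq I) (P : pred I) (F : I -> R) :
  (forall i, P i -> 0 <= F i) -> 0 <= \big[Rplus/0]_(i <- s | P i) F i.
Proof.
move=> H; elim/big_ind: _ => // [|x y]; [exact: Rle_refl | exact: Rplus_le_le_0_compat].
Qed.

Lemma sumR_le (I : Type) (s : seq I) (P : pred I) (F G : I -> R) :
  (forall i, P i -> F i <= G i) ->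
  \big[Rplus/0]_(i <- s | P i) F i <= \big[Rplus/0]_(i <- s | P i) G i.
Proof.
move=> H; elim/big_ind2: _ => // [|x y z t]; [exact: Rle_refl | exact: Rplus_le_compat].
Qed.

Lemma Rabs_sum (I : Type) (s : seq I) (P : pred I) (F : I -> R) :
  Rabs (\big[Rplus/0]_(i <- s | P i) F i) <= \big[Rplus/0]_(i <- s | P i) Rabs (F i).
Proof.
elim/big_rec2: _ => [|i x y _ H]; first by rewrite Rabs_R0; exact: Rle_refl.
by apply: Rle_trans (Rabs_triang _ _) _; apply: Rplus_le_compat_l.
Qed.

Lemma sumR_distrr (I : Type) (s : seq I) (P : pred I) (F : I -> R) c :
  c * \big[Rplus/0]_(i <- s | P i) F i = \big[Rplus/0]_(i <- s | P i) (c * F i).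
Proof.
elim/big_rec2: _ => [|i x y _ <-]; [exact: Rmult_0_r | exact: Rmult_plus_distr_l].
Qed.

(** * Homogeneous polynomials as weighted lists of words *)

Section HomogeneousPolynomials.

Variable T : finType.
Implicit Types (h : T -> R) (H : (T -> R) -> R) (u : seq T).

Definition weval h u : R := \big[Rmult/1]_(j <- u) h j.

Definition leval d h (L : seq (R * d.-tuple T)) : R :=
  \big[Rplus/0]_(q <- L) (q.1 * weval h q.2).

Definition lnorm d (L : seq (R * d.-tuple T)) : R := \big[Rplus/0]_(q <- L) Rabs q.1.

(* [H] is a homogeneous polynomial of degree [d] whose coefficients have
   absolute sum at most [M]; a monomial is a word, so that products are
   concatenations. *)
Definition hpoly (d : nat) (M : R) H : Prop :=
  exists L : seq (R * d.-tuple T), lnorm L <= M /\ forall h, H h = leval h L.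

Lemma weval_le h u r : (forall j, Rabs (h j) <= r) -> Rabs (weval h u) <= r ^ size u.
Proof.
move=> hr; rewrite /weval; elim: u => [|j u IH] /=.
  by rewrite big_nil Rabs_R1; exact: Rle_refl.
rewrite big_cons Rabs_mult; apply: Rmult_le_compat => //; exact: Rabs_pos.
Qed.

Lemma hpoly_ge0 d M H : hpoly d M H -> 0 <= M.
Proof.
case=> L [LM _]; apply: Rle_trans LM; apply: sumR_ge0 => q _; exact: Rabs_pos.
Qed.

Lemma leval_le d (L : seq (R * d.-tuple T)) h r :
  (forall j, Rabs (h j) <= r) ->
  \big[Rplus/0]_(q <- L) Rabs (q.1 * weval h q.2) <= lnorm L * r ^ d.
Proof.
move=> hr; rewrite Rmult_comm sumR_distrr; apply: sumR_le => q _.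
rewrite Rabs_mult Rmult_comm; apply: Rmult_le_compat_r; first exact: Rabs_pos.
by have := weval_le q.2 hr; rewrite size_tuple.
Qed.

Lemma hpoly_le d M H h r : hpoly d M H -> 0 <= r -> (forall j, Rabs (h j) <= r) ->
  Rabs (H h) <= M * r ^ d.
Proof.
move=> [L [LM ->]] r0 hr; apply: Rle_trans (Rmult_le_compat_r _ _ _ (pow_le _ d r0) LM).
exact: Rle_trans (Rabs_sum _ _ _) (leval_le _ hr).
Qed.

Lemma hpoly_weaken d M M' H : M <= M' -> hpoly d M H -> hpoly d M' H.
Proof. by move=> MM [L [LM HL]]; exists L; split=> //; apply: Rle_trans MM. Qed.

Lemma hpoly0 d : hpoly d 0 (fun _ => 0).
Proof.
exists [::]; split=> [|h]; rewrite /lnorm /leval big_nil //; exact: Rle_refl.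
Qed.

Lemma hpoly_const c : hpoly 0 (Rabs c) (fun _ => c).
Proof.
exists [:: (c, [tuple])]; split=> [|h]; rewrite /lnorm /leval /weval big_seq1 /=.
  exact: Rle_refl.
by rewrite big_nil Rmult_1_r.
Qed.

Lemma hpoly_coord j : hpoly 1 1 (fun h => h j).
Proof.
exists [:: (1, [tuple j])]; split=> [|h]; rewrite /lnorm /leval /weval big_seq1 /=.
  by rewrite Rabs_R1; exact: Rle_refl.
by rewrite big_seq1 Rmult_1_l.
Qed.

Lemma hpolyD d M M' H H' :
  hpoly d M H -> hpoly d M' H' -> hpoly d (M + M') (fun h => H h + H' h).
Proof.
move=> [L [LM HL]] [L' [LM' HL']]; exists (L ++ L'); split.
- by rewrite /lnorm big_cat; apply: Rplus_le_compat.
- by move=> h; rewrite /leval big_cat HL HL'.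
Qed.

Lemma hpolyZ d M H c : hpoly d M H -> hpoly d (Rabs c * M) (fun h => c * H h).
Proof.
move=> [L [LM HL]]; exists [seq (c * q.1, q.2) | q <- L]; split.
- rewrite /lnorm big_map /=; under eq_bigr => q _ do rewrite Rabs_mult.
  rewrite -sumR_distrr; apply: Rmult_le_compat_l => //; exact: Rabs_pos.
- move=> h; rewrite HL /leval big_map sumR_distrr; apply: eq_bigr => q _ /=; ring.
Qed.

Lemma hpolyM d d' M M' H H' :
  hpoly d M H -> hpoly d' M' H' -> hpoly (d + d') (M * M') (fun h => H h * H' h).
Proof.
move=> [L [LM HL]] [L' [LM' HL']].
exists [seq (q.1 * q'.1, cat_tuple q.2 q'.2) | q <- L, q' <- L']; split.
- rewrite /lnorm big_allpairs_dep /=.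
  under eq_bigr => q _.
    under eq_bigr => q' _ do rewrite Rabs_mult.
    rewrite -sumR_distrr Rmult_comm; over.
  rewrite -sumR_distrr Rmult_comm; apply: Rmult_le_compat => //;
    apply: sumR_ge0 => q _; exact: Rabs_pos.
- move=> h; rewrite HL HL' /leval big_allpairs_dep Rmult_comm sumR_distrr.
  apply: eq_bigr => q _; rewrite Rmult_comm sumR_distrr.
  apply: eq_bigr => q' _; rewrite /weval big_cat /=; ring.
Qed.

Lemma hpoly_sum (P : nat -> (T -> R) -> R) (M : nat -> R) d n :
  (forall k, (k <= n)%N -> hpoly d (M k) (P k)) ->
  hpoly d (sum_f_R0 M n) (fun h => sum_f_R0 (fun k => P k h) n).
Proof.
elim: n => [|n IH] HP /=; first exact: HP.
by apply: hpolyD; [apply: IH => k kn; apply: HP; apply: leqW | apply: HP].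
Qed.

(** * From words to exponents *)

Definition content u (k : T -> nat) : bool := [forall j, count_mem j u == k j].

Lemma weval_count h u : weval h u = \big[Rmult/1]_(j : T) h j ^ count_mem j u.
Proof.
rewrite /weval; elim: u => [|x u IH].
  by rewrite big_nil big1.
rewrite big_cons IH /= (bigD1 x) // [in RHS](bigD1 x) //= eqxx add1n /= Rmult_assoc.
congr (_ * (_ * _)); apply: eq_bigr => j jx.
by rewrite eq_sym (negbTE jx).
Qed.

Lemma sum_count u : (\sum_(j : T) count_mem j u)%N = size u.
Proof.
elim: u => [|x u IH] /=; first by rewrite big1.
by rewrite big_split IH (bigD1 x) //= eqxx big1 // => j jx; rewrite eq_sym (negbTE jx).
Qed.

(** A word of length [d] has exactly one exponent function, with values at most [d], so grouping by
    content visits each word once. *)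
Lemma content_sum d (L : seq (R * d.-tuple T)) (G : R * d.-tuple T -> R) :
  \big[Rplus/0]_(k : {ffun T -> 'I_d.+1} | (\sum_(j : T) nat_of_ord (k j) == d)%N)
     \big[Rplus/0]_(q <- L | content q.2 (fun j => k j)) G q =
  \big[Rplus/0]_(q <- L) G q.
Proof.
rewrite (exchange_big_dep predT) //=; apply: eq_bigr => q _.
have cd j : (count_mem j q.2 < d.+1)%N by have := count_size (pred1 j) q.2; rewrite size_tuple.
rewrite (big_pred1 [ffun j => Ordinal (cd j)]) // => k /=; apply/andP/eqP => [[_ /forallP qk]|->].
  by apply/ffunP=> j; apply/val_inj; rewrite ffunE /= (eqP (qk j)).
split; last by apply/forallP => j; rewrite ffunE.
by under eq_bigr => j _ do rewrite ffunE /=; rewrite sum_count size_tuple.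
Qed.

Definition coefw (L : forall d, seq (R * d.-tuple T)) d (e : T -> nat) : R :=
  \big[Rplus/0]_(q <- L d | content q.2 e) q.1.

(** The degree is recovered from the exponents, so that one coefficient function serves all degrees,
    as [analytic_on] demands. *)
Definition coef (L : forall d, seq (R * d.-tuple T)) (e : T -> nat) : R :=
  coefw L (\sum_(j : T) e j)%N e.

Lemma mono_termE L d (p x : T -> R) (k : {ffun T -> 'I_d.+1}) :
  (\sum_(j : T) nat_of_ord (k j) == d)%N ->
  mono_term (coef L) p x k =
  \big[Rplus/0]_(q <- L d | content q.2 (fun j => k j))
     (q.1 * weval (fun j => x j - p j) q.2).
Proof.
move=> /eqP kd; rewrite /mono_term /coef kd Rmult_comm /coefw sumR_distrr.
apply: eq_bigr => q /forallP qk; rewrite Rmult_comm weval_count; congr (_ * _).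
by apply: eq_bigr => j _; rewrite (eqP (qk j)).
Qed.

Lemma deg_blockE L p x d :
  deg_block (coef L) p x d = leval (fun j => x j - p j) (L d).
Proof. by rewrite /leval -content_sum; apply: eq_bigr => k; exact: mono_termE. Qed.

(** Collecting the words of one monomial can only lower the absolute sum, by the triangle
    inequality. *)
Lemma deg_block_abs_le L p x d r : (forall j, Rabs (x j - p j) <= r) ->
  0 <= deg_block_abs (coef L) p x d <= lnorm (L d) * r ^ d.
Proof.
move=> hr; split; first by apply: sumR_ge0 => k _; exact: Rabs_pos.
apply: Rle_trans (leval_le _ hr); rewrite -content_sum; apply: sumR_le => k kd.
by rewrite (mono_termE _ _ _ kd); exact: Rabs_sum.
Qed.

(* The single constant [K] controls both the growth of the blocks and the radius
   [1 / (2 K)], so that it can be enlarged freely and the blocks are dominated by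
   [C (1/2)^d]. *)
Definition pser (p : T -> R) (F : (T -> R) -> R) C K (H : nat -> (T -> R) -> R) :=
  [/\ 0 < K, forall d, hpoly d (C * K ^ d) (H d) &
      forall x, (forall j, Rabs (x j - p j) < / (2 * K)) ->
        is_series (fun d => H d (fun j => x j - p j)) (F x)].

Definition analytic_at p F := exists C K Hs, pser p F C K Hs.

Lemma pser_ge0 p F C K Hs : pser p F C K Hs -> 0 <= C.
Proof. by case=> _ /(_ 0%N) /hpoly_ge0; rewrite Rmult_1_r. Qed.

Lemma half_geom C : ex_series (fun d => C * (/2) ^ d).
Proof.
by apply: ex_series_scal_l; apply: ex_series_geom; rewrite Rabs_right; lra.
Qed.

Lemma pow_half K d : 0 < K -> K ^ d * (/ (2 * K)) ^ d = (/2) ^ d.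
Proof. move=> K0; rewrite -Rpow_mult_distr; congr (_ ^ _); field; lra. Qed.

Lemma analytic_atP (D : (T -> R) -> Prop) F :
  (forall p, D p -> analytic_at p F) -> analytic_on D F.
Proof.
move=> an p /an [C [K [Hs [K0 HH HF]]]].
pose r := / (2 * K).
have r0 : 0 < r by apply: Rinv_0_lt_compat; lra.
exists r; split=> //.
(* [hpoly] only asserts a list for each degree; choice turns these into one family, from which the
   coefficients are read off. *)
pose LP d := constructive_indefinite_description _ (HH d).
pose L d := proj1_sig (LP d).
have [L1 L2] : (forall d, lnorm (L d) <= C * K ^ d) /\ (forall d h, Hs d h = leval h (L d)).
  by split=> d; case: (proj2_sig (LP d)).
exists (coef L) => x xr; split.
  have [l hl] : ex_series (deg_block_abs (coef L) p x).
    apply: (@ex_series_le R_AbsRing R_CompleteNormedModule _ (fun d => C * (/2) ^ d));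
      last exact: half_geom.
    move=> d; have [b0 b1] := deg_block_abs_le L d (fun j => Rlt_le _ _ (xr j)).
    rewrite /norm /= /abs /= Rabs_right; last lra.
    apply: Rle_trans b1 _; rewrite -(pow_half d K0) -Rmult_assoc.
    by apply: Rmult_le_compat_r => //; apply: pow_le; lra.
  by exists l; move/is_series_Reals: hl.
have /is_series_Reals := HF x xr.
rewrite /infinite_sum => hs e /hs [N HN]; exists N => n /HN.
by rewrite (PartSum.sum_eq _ (deg_block (coef L) p x)) // => k _; rewrite deg_blockE L2.
Qed.

Lemma pser_weaken p F C K C' K' Hs : C <= C' -> K <= K' -> pser p F C K Hs -> pser p F C' K' Hs.
Proof.
move=> CC KK ps; have C0 := pser_ge0 ps; have [K0 HH HF] := ps; split; first lra.
  move=> d; apply: hpoly_weaken (HH d).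
  apply: Rmult_le_compat => //; [apply: pow_le; lra | apply: pow_incr; lra].
move=> x xr; apply: HF => j; apply: Rlt_le_trans (xr j) _.
apply: Rinv_le_contravar; lra.
Qed.

Lemma pser_term p F C K Hs d h r : pser p F C K Hs -> 0 <= r ->
  (forall j, Rabs (h j) <= r) -> Rabs (Hs d h) <= C * (K * r) ^ d.
Proof.
case=> _ HH _ r0 hr; apply: Rle_trans (hpoly_le (HH d) r0 hr) _.
by rewrite Rpow_mult_distr Rmult_assoc; exact: Rle_refl.
Qed.

Lemma is_series_zero : is_series (fun _ : nat => 0) 0.
Proof.
apply/is_series_Reals => e e0; exists 0%N => n _.
by rewrite sum_eq_R0 // /Rdist Rminus_0_r Rabs_R0.
Qed.

Lemma is_series_cons (a : nat -> R) l : is_series (fun n => a n.+1) (l - a 0%N) -> is_series a l.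
Proof. by move=> H; apply: is_series_decr_1. Qed.

(** * Closure of analyticity under sums and products *)

Lemma analytic_at_const p c : analytic_at p (fun _ => c).
Proof.
exists (Rabs c), 1, (fun d _ => if d is 0%N then c else 0); split; first lra.
  case=> [|d]; first by rewrite Rmult_1_r; exact: hpoly_const.
  rewrite pow1 Rmult_1_r; apply: hpoly_weaken (hpoly0 _); exact: Rabs_pos.
move=> x _; apply: is_series_cons; rewrite Rminus_diag; exact: is_series_zero.
Qed.

Lemma analytic_at_coord p j : analytic_at p (fun x => x j).
Proof.
exists (Rabs (p j) + 1), 1,
  (fun d h => if d is 0%N then p j else if d is 1%N then h j else 0); split; first lra.
  have p0 := Rabs_pos (p j).
  case=> [|[|d]]; rewrite pow1 Rmult_1_r.
  - apply: hpoly_weaken (hpoly_const _); lra.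
  - apply: hpoly_weaken (hpoly_coord _); lra.
  - apply: hpoly_weaken (hpoly0 _); lra.
move=> x _; apply: is_series_cons; apply: is_series_cons; rewrite Rminus_diag.
exact: is_series_zero.
Qed.

Lemma analytic_atD p F G : analytic_at p F -> analytic_at p G ->
  analytic_at p (fun x => F x + G x).
Proof.
move=> [C [K [Hs psF]]] [C' [K' [Hs' psG]]].
have [K0 HH HF] := pser_weaken (Rle_refl _) (Rmax_l K K') psF.
have [_ HH' HG] := pser_weaken (Rle_refl _) (Rmax_r K K') psG.
exists (C + C'), (Rmax K K'), (fun d h => Hs d h + Hs' d h); split=> //.
  move=> d; rewrite Rmult_plus_distr_r; exact: hpolyD.
move=> x xr; apply: is_series_plus; [exact: HF | exact: HG].
Qed.

(** The number [n + 1] of terms is absorbed into [2 ^ n], at the price of a larger geometric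
    ratio. *)
Lemma sum_le_pow2 (a : nat -> R) M n : 0 <= M -> (forall k, (k <= n)%N -> a k <= M) ->
  sum_f_R0 a n <= 2 ^ n * M.
Proof.
move=> M0; elim: n => [|n IH] Ha /=; first by rewrite Rmult_1_l; apply: Ha.
have := IH (fun k kn => Ha k (leqW kn)); have := Ha n.+1 (leqnn _).
have : 1 * M <= 2 ^ n * M by apply: Rmult_le_compat_r => //; apply: pow_R1_Rle; lra.
lra.
Qed.

Lemma pser_abs p F C K Hs h r : pser p F C K Hs -> 0 <= r <= / (2 * K) ->
  (forall j, Rabs (h j) <= r) -> ex_series (fun d => Rabs (Hs d h)).
Proof.
move=> ps r0 hr; apply: (@ex_series_le R_AbsRing R_CompleteNormedModule _ (fun d => C * (/2) ^ d));
  last exact: half_geom.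
have [K0 _ _] := ps.
move=> d; rewrite /norm /= /abs /= Rabs_Rabsolu -(pow_half d K0) -Rpow_mult_distr.
apply: (pser_term d ps) => [|j]; last by have := hr j; lra.
lra.
Qed.

(** The blocks of the product are Cauchy products; their [d + 1] terms cost a factor [2 ^ d], hence
    the doubled [K]. The halved radius still gives the absolute convergence that the Cauchy product
    requires. *)
Lemma analytic_atM p F G : analytic_at p F -> analytic_at p G ->
  analytic_at p (fun x => F x * G x).
Proof.
move=> [C [K1 [Hs psF']]] [C' [K2 [Hs' psG']]].
pose K := Rmax K1 K2.
have psF := pser_weaken (Rle_refl _) (Rmax_l K1 K2) psF'.
have psG := pser_weaken (Rle_refl _) (Rmax_r K1 K2) psG'.
have C0 := pser_ge0 psF; have C0' := pser_ge0 psG.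
have [K0 HH HF] := psF; have [_ HH' HG] := psG; rewrite -/K in K0 HH HH' HF HG psF psG.
have KK : / (2 * (2 * K)) < / (2 * K) by apply: Rinv_lt_contravar; [nra | lra].
exists (C * C'), (2 * K),
  (fun d h => sum_f_R0 (fun i => Hs i h * Hs' (d - i)%N h) d); split; first lra.
  move=> d; apply: (@hpoly_weaken _ (sum_f_R0 (fun i => (C * K ^ i) * (C' * K ^ (d - i)%N)) d)).
    have -> : C * C' * (2 * K) ^ d = 2 ^ d * (C * C' * K ^ d) by rewrite Rpow_mult_distr; ring.
    apply: sum_le_pow2.
      by apply: Rmult_le_pos; [exact: Rmult_le_pos | apply: pow_le; lra].
    move=> k kd; right; rewrite -{2}(subnKC kd) pow_add; ring.
  by apply: hpoly_sum => k kd; rewrite -{1}(subnKC kd); exact: hpolyM.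
move=> x xr.
have xr' j : Rabs (x j - p j) < / (2 * K) by have := xr j; lra.
have K3 : 0 < / (2 * K) by apply: Rinv_0_lt_compat; lra.
have hr : forall j, Rabs (x j - p j) <= / (2 * K) by move=> j; apply: Rlt_le.
have K4 : 0 <= / (2 * K) <= / (2 * K) by lra.
apply: (is_series_mult _ _ _ _ (HF _ xr') (HG _ xr')); [exact: pser_abs psF K4 hr | exact: pser_abs psG K4 hr].
Qed.

(** * Tails, powers and composition of series *)

Lemma series_tail (a : nat -> R) l A q N : is_series a l -> 0 <= A -> 0 <= q <= /2 ->
  (forall n, Rabs (a n) <= A * q ^ n) ->
  Rabs (l - sum_f_R0 a N) <= 2 * A * q ^ N.+1.
Proof.
move=> /is_series_Reals al A0 q0 Ha.
(* The subtracted term makes the induction telescope: since [2 q <= 1], a new term [A q^j] is at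
   most [2 A q^j - 2 A q^(j+1)]. *)
have P k : Rabs (sum_f_R0 a (N + k) - sum_f_R0 a N) <= 2 * A * q ^ N.+1 - 2 * A * q ^ (N + k).+1.
  elim: k => [|k IH]; first by rewrite addn0 Rminus_diag Rminus_diag Rabs_R0; lra.
  rewrite addnS [sum_f_R0 a _.+1]/=.
  have -> : sum_f_R0 a (N + k) + a (N + k).+1 - sum_f_R0 a N =
    (sum_f_R0 a (N + k) - sum_f_R0 a N) + a (N + k).+1 by ring.
  apply: Rle_trans (Rabs_triang _ _) _; have := Ha (N + k).+1.
  have Q0 : 0 <= A * q ^ (N + k).+1 by apply: Rmult_le_pos => //; apply: pow_le; lra.
  have -> : 2 * A * q ^ (N + k).+2 = 2 * q * (A * q ^ (N + k).+1) by rewrite /=; ring.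
  have : 2 * q * (A * q ^ (N + k).+1) <= 1 * (A * q ^ (N + k).+1).
    by apply: Rmult_le_compat_r => //; lra.
  lra.
apply: le_epsilon => e e0; have [M HM] := al e e0.
have := HM (N + M)%N ltac:(apply/leP; exact: leq_addl); rewrite /Rdist => HM'.
have Q0 : 0 <= 2 * A * q ^ (N + M).+1.
  by apply: Rmult_le_pos; [lra | apply: pow_le; lra].
have -> : l - sum_f_R0 a N = - (sum_f_R0 a (N + M) - l) + (sum_f_R0 a (N + M) - sum_f_R0 a N) by ring.
apply: Rle_trans (Rabs_triang _ _) _; rewrite Rabs_Ropp; have := P M; lra.
Qed.

Lemma hpoly0_cst M H h h' : hpoly 0 M H -> H h = H h'.
Proof.
move=> [L [_ HL]]; rewrite !HL; apply: eq_bigr => q _.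
by rewrite (tuple0 q.2) /weval !big_nil.
Qed.

(** At [x = p] all blocks of positive degree vanish, so [F p] is the block of degree 0, and deleting
    this block subtracts [F p]. *)
Lemma pser_sub p F C K Hs x : pser p F C K Hs -> (forall j, Rabs (x j - p j) < / (2 * K)) ->
  is_series (fun d => if d is 0%N then 0 else Hs d (fun j => x j - p j)) (F x - F p).
Proof.
move=> ps xr; have [K0 HH HF] := ps.
have rp j : Rabs (p j - p j) <= 0 by rewrite Rminus_diag Rabs_R0; lra.
have K3 : 0 < / (2 * K) by apply: Rinv_0_lt_compat; lra.
have Fp : F p = Hs 0%N (fun j => p j - p j).
  have S1 := HF p (fun j => Rle_lt_trans _ _ _ (rp j) K3).
  have S2 : is_series (fun d => Hs d (fun j => p j - p j)) (Hs 0%N (fun j => p j - p j)).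
    apply: is_series_cons; rewrite Rminus_diag; apply: is_series_ext is_series_zero => n.
    have := pser_term n.+1 ps (Rle_refl 0) rp; rewrite Rmult_0_r /= Rmult_0_l Rmult_0_r.
    by case: (Req_dec (Hs n.+1 (fun j => p j - p j)) 0) => // /Rabs_pos_lt; lra.
  by rewrite -(is_series_unique _ _ S1) (is_series_unique _ _ S2).
rewrite Fp (hpoly0_cst _ (fun j => x j - p j) (HH 0%N)).
apply: is_series_cons; apply: (is_series_incr_1 (fun d => Hs d (fun j => x j - p j))).
rewrite /plus /=; have E (u v : R) : u - v - 0 + v = u by ring.
rewrite E.
exact: HF.
Qed.

(* The degree [d] block of the [m]-th power of the series without constant term. *)
Fixpoint pow_block (Hs : nat -> (T -> R) -> R) m d h : R :=
  if m is m'.+1 then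
    sum_f_R0 (fun i => (if i is 0%N then 0 else Hs i h) * pow_block Hs m' (d - i)%N h) d
  else if d is 0%N then 1 else 0.

(** Each of the [m] factors lacks a constant term and so contributes degree at least one. *)
Lemma pow_block_eq0 Hs m d h : (d < m)%N -> pow_block Hs m d h = 0.
Proof.
elim: m d => // m IH d dm /=; apply: sum_eq_R0 => -[|i] id; first by rewrite Rmult_0_l.
rewrite IH ?Rmult_0_r //; move/leP: id => id.
by rewrite ltnS in dm; apply: leq_trans dm; rewrite ltn_subrL (leq_trans _ id).
Qed.

(* Dropping the constant term and doubling [K] pays for the Cauchy product: the
   inner sum is [C^(m+1) (2K)^d] times a sum of [2^-i] over [1 <= i <= d]. *)
Lemma pow_block_hpoly p F C K Hs m d : pser p F C K Hs ->
  hpoly d (C ^ m * (2 * K) ^ d) (pow_block Hs m d).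
Proof.
move=> ps; have C0 := pser_ge0 ps; have [K0 HH _] := ps.
elim: m d => [|m IH] d.
  case: d => [|d] /=.
    by apply: hpoly_weaken (hpoly_const 1); rewrite Rabs_R1; lra.
  apply: hpoly_weaken (hpoly0 _); rewrite Rmult_1_l; apply: (pow_le _ d.+1); lra.
apply: (@hpoly_weaken _ (sum_f_R0 (fun i => (if i is 0%N then 0 else C * K ^ i) *
    (C ^ m * (2 * K) ^ (d - i)%N)) d)); last first.
  apply: hpoly_sum => k kd; rewrite -{1}(subnKC kd); apply: hpolyM => //.
  case: k {kd} => [|k] //; exact: hpoly0.
have Q0 : 0 <= C ^ m.+1 * (2 * K) ^ d.
  by apply: Rmult_le_pos; apply: pow_le; lra.
suff P n : (n <= d)%N -> sum_f_R0 (fun i => (if i is 0%N then 0 else C * K ^ i) *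
    (C ^ m * (2 * K) ^ (d - i)%N)) n <= C ^ m.+1 * (2 * K) ^ d * (1 - (/2) ^ n).
  apply: Rle_trans (P d (leqnn d)) _.
  have : 0 <= (/2) ^ d by apply: pow_le; lra.
  nra.
elim: n => [|n IHn] nd; first by rewrite /=; lra.
rewrite [sum_f_R0 _ _.+1]/=; have := IHn (ltnW nd).
have -> : (2 * K) ^ d = (2 * K) ^ n.+1 * (2 * K) ^ (d - n.+1)%N.
  by rewrite -pow_add; congr (_ ^ _); rewrite -[in LHS](subnKC nd).
have -> : (2 * K) ^ n.+1 = 2 ^ n.+1 * K ^ n.+1 by rewrite Rpow_mult_distr.
have -> : (/2) ^ n.+1 = / 2 ^ n.+1 by rewrite pow_inv.
have -> : (/2) ^ n = 2 * / 2 ^ n.+1.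
  by rewrite pow_inv /=; field; apply: pow_nonzero; lra.
have T0 : 2 ^ n.+1 <> 0 by apply: pow_nonzero; lra.
move=> IH'.
apply: Rle_trans (Rplus_le_compat_r _ _ _ IH') _; right; rewrite /=.
by field; apply: pow_nonzero; lra.
Qed.

(** Induction on [m] by Cauchy products. The blocks of the powers grow like [(2 K)^d], so the radius
    [/ (4 K)] keeps them below [C^m (1/2)^d], which gives absolute convergence. *)
Lemma pow_block_series p F C K Hs x m : pser p F C K Hs ->
  (forall j, Rabs (x j - p j) <= / (4 * K)) ->
  is_series (fun d => pow_block Hs m d (fun j => x j - p j)) ((F x - F p) ^ m).
Proof.
move=> ps xr; have [K0 HH HF] := ps; have C0 := pser_ge0 ps.
have K4 : / (4 * K) < / (2 * K) by apply: Rinv_lt_contravar; nra.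
have K5 : 0 < / (4 * K) by apply: Rinv_0_lt_compat; lra.
have xr' j : Rabs (x j - p j) < / (2 * K) by have := xr j; lra.
elim: m => [|m IH].
  by rewrite /=; apply: is_series_cons; rewrite Rminus_diag; exact: is_series_zero.
rewrite [_ ^ m.+1]/=; apply: (is_series_mult _ _ _ _ (pser_sub ps xr') IH).
  apply: (@ex_series_le R_AbsRing R_CompleteNormedModule _ (fun d => C * (/2) ^ d));
    last exact: half_geom.
  move=> d; rewrite /norm /= /abs /= Rabs_Rabsolu -(pow_half d K0) -Rpow_mult_distr.
  have K6 : 0 <= / (2 * K) by lra.
  case: d => [|d]; first by rewrite Rabs_R0 /=; lra.
  by apply: (pser_term d.+1 ps K6) => j; apply: Rlt_le.
apply: (@ex_series_le R_AbsRing R_CompleteNormedModule _ (fun d => C ^ m * (/2) ^ d));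
  last exact: half_geom.
move=> d; rewrite /norm /= /abs /= Rabs_Rabsolu.
have K7 : 0 < 2 * K by lra.
rewrite -(pow_half d K7) -Rmult_assoc.
have -> : 2 * (2 * K) = 4 * K by ring.
apply: hpoly_le xr; [exact: pow_block_hpoly ps | lra].
Qed.

(** One-variable counterpart of [pser], with the expansion required for all [|s| < 1 / L]. *)
Definition useries (phi : R -> R) t0 B L (b : nat -> R) :=
  [/\ 0 < L, forall m, Rabs (b m) <= B * L ^ m &
      forall s, Rabs s < / L -> is_series (fun m => b m * s ^ m) (phi (t0 + s))].

Definition uanalytic_at (phi : R -> R) t0 := exists B L b, useries phi t0 B L b.

Lemma useries_weaken phi t0 B L L' b : L <= L' -> useries phi t0 B L b -> useries phi t0 B L' b.
Proof.
move=> LL [L0 Hb Hs]; split; first lra.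
  move=> m; apply: Rle_trans (Hb m) _; apply: Rmult_le_compat_l.
    have := Hb 0%N; have := Rabs_pos (b 0%N); rewrite /=; lra.
  apply: pow_incr; lra.
move=> s sL; apply: Hs; apply: Rlt_le_trans sL _; apply: Rinv_le_contravar; lra.
Qed.

Lemma pow_ge1_mono a m n : 1 <= a -> (m <= n)%N -> a ^ m <= a ^ n.
Proof. by move=> a1 mn; apply: Rle_pow => //; apply/leP. Qed.

(** The terms with [d < m] vanish, so the triangle [m <= d <= N] may be completed to a square before
    the sums are exchanged. *)
Lemma sum_swap_triangle (b : nat -> R) (P : nat -> nat -> R) N :
  (forall m d, (d < m)%N -> P m d = 0) ->
  sum_f_R0 (fun d => sum_f_R0 (fun m => b m * P m d) d) N =
  sum_f_R0 (fun m => b m * sum_f_R0 (P m) N) N.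
Proof.
move=> P0; elim: N => [|N IH] //.
rewrite [LHS]/= IH [RHS]/=.
have -> : sum_f_R0 (P N.+1) N = 0 by apply: sum_eq_R0 => d /leP dN; apply: P0.
have -> : sum_f_R0 (fun m => b m * (sum_f_R0 (P m) N + P m N.+1)) N =
   sum_f_R0 (fun m => b m * sum_f_R0 (P m) N) N + sum_f_R0 (fun m => b m * P m N.+1) N.
  by rewrite -sum_plus; apply: PartSum.sum_eq => m _; ring.
ring.
Qed.

Lemma series_of_close (a b : nat -> R) l M q : 0 <= q < 1 -> is_series b l ->
  (forall N, Rabs (sum_f_R0 a N - sum_f_R0 b N) <= M * q ^ N) -> is_series a l.
Proof.
move=> q01 bl Hab.
have Z : is_lim_seq (fun N => M * q ^ N) 0.
  rewrite -(Rmult_0_r M); apply: is_lim_seq_mult'; first exact: is_lim_seq_const.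
  by apply: is_lim_seq_geom; rewrite Rabs_right; lra.
have D : is_lim_seq (fun N => sum_f_R0 a N - sum_f_R0 b N) 0.
  apply/is_lim_seq_abs_0; apply: is_lim_seq_le_le Z; last exact: is_lim_seq_const.
  by move=> N; split=> //; exact: Rabs_pos.
apply/is_series_Reals.
suff : is_lim_seq (sum_f_R0 a) l by move/is_lim_seq_Reals.
have bl' : is_lim_seq (sum_f_R0 b) l by apply/is_lim_seq_Reals; move/is_series_Reals: bl.
have := is_lim_seq_plus' _ _ _ _ D bl'; rewrite Rplus_0_l.
by apply: is_lim_seq_ext => N; ring.
Qed.

(* Regrouping [sum_m b_m (F - F p)^m] by degree: the first [N] blocks of the
   result involve only the powers [m <= N], and differ from the partial sum over
   [m <= N] by the tails of these powers, which are geometrically small. *)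
Lemma analytic_at_comp p F phi : analytic_at p F -> uanalytic_at phi (F p) ->
  analytic_at p (fun x => phi (F x)).
Proof.
move=> [C1 [K [Hs ps1]]] [B [L1 [b us1]]].
(* Bounds of at least 1 make [(L C)^m] increasing in [m], so that powers [m <= d] are controlled by
   the last one. *)
pose C := Rmax C1 1; pose L := Rmax L1 1.
have C_1 : 1 <= C := Rmax_r _ _; have L_1 : 1 <= L := Rmax_r _ _.
have ps : pser p F C K Hs := pser_weaken (Rmax_l _ _) (Rle_refl _) ps1.
have [_ Hb Hphi] := useries_weaken (Rmax_l L1 1) us1; rewrite -/L in Hb Hphi.
have [K0 HH HF] := ps.
have B0 : 0 <= B by have := Hb 0%N; have := Rabs_pos (b 0%N); rewrite /=; lra.
have LC1 : 1 <= L * C by nra.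
(* The block bound needs [K' >= 4 L C K]. The factor 8 makes the ratio [q = 2 K / (2 K')] equal to
   [1 / (8 L C)], small enough for the tail estimate, for [|F x - F p| < 1 / L] and for the final
   ratio [2 L C q = 1/4]. *)
pose K' := 8 * (L * C) * K.
have KK' : 8 * K <= K' by rewrite /K'; nra.
exists B, K', (fun d h => sum_f_R0 (fun m => b m * pow_block Hs m d h) d); split; first lra.
  move=> d.
  apply: (@hpoly_weaken _ (sum_f_R0 (fun m => Rabs (b m) * (C ^ m * (2 * K) ^ d)) d)).
    apply: Rle_trans (sum_le_pow2 (M := B * (L * C) ^ d * (2 * K) ^ d) _ _) _.
    + by repeat apply: Rmult_le_pos => //; apply: pow_le; lra.
    + move=> m md; rewrite -Rmult_assoc; apply: Rmult_le_compat_r; first by apply: pow_le; lra.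
      apply: Rle_trans (Rmult_le_compat_r _ _ _ _ (Hb m)) _; first by apply: pow_le; lra.
      rewrite Rmult_assoc -Rpow_mult_distr; apply: Rmult_le_compat_l => //.
      exact: pow_ge1_mono.
    + have -> : 2 ^ d * (B * (L * C) ^ d * (2 * K) ^ d) = B * (4 * (L * C) * K) ^ d.
        have -> : 4 * (L * C) * K = 2 * ((L * C) * (2 * K)) by ring.
        by rewrite !Rpow_mult_distr; ring.
      apply: Rmult_le_compat_l => //; apply: pow_incr; rewrite /K'; nra.
  by apply: hpoly_sum => m _; apply: hpolyZ; exact: pow_block_hpoly ps.
move=> x xr.
have K'0 : 0 < K' by lra.
have R0 : 0 < / (2 * K') by apply: Rinv_0_lt_compat; lra.
have r4 : / (2 * K') <= / (4 * K) by apply: Rinv_le_contravar; lra.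
have r2 : / (2 * K') < / (2 * K) by apply: Rinv_lt_contravar; nra.
have xr4 j : Rabs (x j - p j) <= / (4 * K) by have := xr j; lra.
have xr2 j : Rabs (x j - p j) < / (2 * K) by have := xr j; lra.
pose s := F x - F p; pose h := fun j => x j - p j.
pose q := / (8 * (L * C)).
have q0 : 0 < q by apply: Rinv_0_lt_compat; lra.
have q8 : q <= / 8 by apply: Rinv_le_contravar; lra.
have qE : 2 * K * / (2 * K') = q by rewrite /q /K'; field; lra.
have sP m : is_series (fun d => pow_block Hs m d h) (s ^ m) := pow_block_series ps xr4.
have Pb m d : Rabs (pow_block Hs m d h) <= C ^ m * q ^ d.
  rewrite -qE Rpow_mult_distr -Rmult_assoc.
  apply: hpoly_le; [exact: pow_block_hpoly ps | lra | by move=> j; apply: Rlt_le; exact: xr].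
have q2 : 0 <= q <= / 2 by lra.
have tail m N : Rabs (s ^ m - sum_f_R0 (fun d => pow_block Hs m d h) N) <= 2 * C ^ m * q ^ N.+1.
  by apply: series_tail (sP m) _ q2 (Pb m); apply: pow_le; lra.
have sL : Rabs s < / L.
  (* The first power has zero block in degree 0, so its tail after that block is [s] itself, whence
     [|s| <= 2 C q]. *)
  have := tail 1%N 0%N; rewrite [sum_f_R0 _ _]/= Rmult_0_l Rminus_0_r !pow_1.
  move=> /Rle_lt_trans; apply.
  have -> : 2 * C * q = / (4 * L) by rewrite /q; field; lra.
  apply: Rinv_lt_contravar; nra.
have := Hphi s sL; have -> : F p + s = F x by rewrite /s; ring.
have q14 : 0 <= / 4 < 1 by lra.
move=> Hser; apply: (series_of_close (M := 2 * B * q) q14 Hser) => N.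
rewrite sum_swap_triangle; last by move=> m d; exact: pow_block_eq0.
rewrite -minus_sum.
have LCq : L * C * q = / 8 by rewrite /q; field; lra.
have qN : 0 <= q ^ N.+1 by apply: pow_le; lra.
apply: Rle_trans (Rsum_abs _ _) _.
(* Each of the [N + 1] tails is at most [M], and [2^N M = 2 B q (2 L C q)^N]. *)
apply: Rle_trans (sum_le_pow2 (M := 2 * B * (L * C) ^ N * q ^ N.+1) _ _) _.
- by repeat apply: Rmult_le_pos => //; [lra | apply: pow_le; lra].
- move=> m mN; rewrite -Rmult_minus_distr_l Rabs_mult Rabs_minus_sym.
  apply: (Rle_trans _ (B * L ^ m * (2 * C ^ m * q ^ N.+1))).
    by apply: Rmult_le_compat => //; exact: Rabs_pos.
  have -> : B * L ^ m * (2 * C ^ m * q ^ N.+1) = 2 * B * (L * C) ^ m * q ^ N.+1.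
    by rewrite Rpow_mult_distr; ring.
  apply: Rmult_le_compat_r => //; apply: Rmult_le_compat_l; first lra.
  exact: pow_ge1_mono.
- right; have -> : / 4 = 2 * (L * C * q) by rewrite LCq; field.
  rewrite !Rpow_mult_distr [q ^ N.+1]/=; ring.
Qed.

End HomogeneousPolynomials.

(** * One-variable series *)

(** A small disc suffices, so [1 / m!] is bounded by 1 and [L = 1]. *)
Lemma uanalytic_exp t0 : uanalytic_at exp t0.
Proof.
exists (exp t0), 1, (fun m => exp t0 * / INR (Factorial.fact m)); split; first lra.
  move=> m; have E0 := exp_pos t0.
  have F1 : 1 <= INR (Factorial.fact m) by apply: (le_INR 1); exact: Factorial.lt_O_fact.
  have I0 : 0 < / INR (Factorial.fact m) by apply: Rinv_0_lt_compat; lra.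
  rewrite pow1 Rabs_right; last by apply: Rle_ge; apply: Rmult_le_pos; lra.
  by apply: Rmult_le_compat_l; [lra | rewrite -Rinv_1; apply: Rinv_le_contravar; lra].
move=> s _; rewrite exp_plus.
have /is_pseries_R /(is_series_scal_l (exp t0)) := is_exp_Reals s.
by apply: is_series_ext => m; rewrite /scal /= /mult /= Rmult_assoc.
Qed.

(** Geometric series of ratio [- s / t0]. *)
Lemma Rinv_series t0 s : t0 <> 0 -> Rabs s < Rabs t0 ->
  is_series (fun m => / t0 * (- / t0) ^ m * s ^ m) (/ (t0 + s)).
Proof.
move=> t00 st.
have T0 : 0 < Rabs t0 by exact: Rabs_pos_lt.
have s0 : t0 + s <> 0.
  by move=> E; have := Rabs_Ropp s; have -> : - s = t0; lra.

have q1 : Rabs (- / t0 * s) < 1.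
  rewrite Rabs_mult Rabs_Ropp Rabs_inv; apply: (Rmult_lt_reg_l (Rabs t0)) => //.
  by rewrite -Rmult_assoc Rinv_r ?Rmult_1_l ?Rmult_1_r //; lra.
have := is_series_scal_l (/ t0) _ _ (is_series_geom _ q1).
have -> : scal (/ t0) (/ (1 - - / t0 * s)) = / (t0 + s).
  by rewrite /scal /= /mult /=; field; split=> //; lra.
by apply: is_series_ext => m; rewrite /scal /= /mult /= Rpow_mult_distr Rmult_assoc.
Qed.

Lemma uanalytic_Rinv t0 : t0 <> 0 -> uanalytic_at Rinv t0.
Proof.
move=> t00; have T0 : 0 < Rabs t0 by exact: Rabs_pos_lt.
exists (/ Rabs t0), (/ Rabs t0), (fun m => / t0 * (- / t0) ^ m); split.
- exact: Rinv_0_lt_compat.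
- by move=> m; rewrite Rabs_mult -RPow_abs Rabs_Ropp Rabs_inv; exact: Rle_refl.
- by move=> s; rewrite Rinv_inv => st; exact: Rinv_series.
Qed.

(** Termwise integration, from 0 to [s], of the series of [1 / (t0 + y)]. *)
Lemma ln_series t0 s : 0 < t0 -> Rabs s < t0 ->
  is_series (fun m => PS_Int (fun m => / t0 * (- / t0) ^ m) m * s ^ m) (ln (t0 + s) - ln t0).
Proof.
move=> t00 st; pose a m := / t0 * (- / t0) ^ m.
have CV : Rbar_lt (Rabs s) (CV_radius a).
  apply: (Rbar_lt_le_trans _ t0) => //; apply: (proj1 (CV_radius_bounded a)).
  exists (/ t0) => m; rewrite /a Rmult_assoc -Rpow_mult_distr.
  have -> : - / t0 * t0 = -1 by field; lra.
  rewrite Rabs_mult pow_1_abs Rmult_1_r Rabs_right; first exact: Rle_refl.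
  by apply: Rle_ge; apply: Rlt_le; exact: Rinv_0_lt_compat.
have st' y : Rmin 0 s <= y <= Rmax 0 s -> Rabs y < t0.
  move=> [y1 y2]; move: st; rewrite /Rmin /Rmax in y1 y2.
  by move: y1 y2; case: Rle_dec => ? ? ? /Rabs_def2 [? ?]; apply: Rabs_def1; lra.
have := is_pseries_RInt a s CV.
have -> : RInt (PSeries a) 0 s = ln (t0 + s) - ln t0.
  apply: is_RInt_unique; rewrite -{2}(Rplus_0_r t0).
  apply: (is_RInt_ext (fun y => / (t0 + y))).
    move=> y y0; apply: esym; apply: is_pseries_unique; apply/is_pseries_R; apply: Rinv_series.
      lra.
    by rewrite (Rabs_right t0); [apply: st'; lra | lra].
  apply: (is_RInt_derive (fun y => ln (t0 + y))) => y /st' /Rabs_def2 [y1 y2].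
    by auto_derive; [lra | field; lra].
  by apply: ex_derive_continuous; auto_derive; lra.
by move/is_pseries_R.
Qed.

Lemma uanalytic_ln t0 : 0 < t0 -> uanalytic_at ln t0.
Proof.
move=> t00; have I0 := Rinv_0_lt_compat _ t00.
pose a m := / t0 * (- / t0) ^ m.
(* The integrated series has zero constant term, replaced here by [ln t0]; the summand 1 in the
   bound takes care of the other coefficients, of size [t0^-m / m]. *)
exists (Rabs (ln t0) + 1), (/ t0), (fun m => if m is 0%N then ln t0 else PS_Int a m); split => //.
  have A0 := Rabs_pos (ln t0).
  case=> [|m]; first by rewrite /=; lra.
  rewrite /PS_Int /a.
  have -> : / t0 * (- / t0) ^ m / INR m.+1 = (-1) ^ m * (/ INR m.+1 * (/ t0) ^ m.+1).
    have -> : - / t0 = -1 * / t0 by ring.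
    by rewrite Rpow_mult_distr /= /Rdiv; ring.
  rewrite Rabs_mult pow_1_abs Rmult_1_l.
  have M1 : 1 <= INR m.+1 by apply: (le_INR 1); apply/leP.
  have J0 : 0 < / INR m.+1 by apply: Rinv_0_lt_compat; lra.
  have J1 : / INR m.+1 <= 1 by rewrite -Rinv_1; apply: Rinv_le_contravar; lra.
  have P0 : 0 < (/ t0) ^ m.+1 by apply: pow_lt.
  rewrite Rabs_right; last by apply: Rle_ge; apply: Rmult_le_pos; lra.
  by apply: Rmult_le_compat_r; lra.
move=> s; rewrite Rinv_inv => st; apply: is_series_cons; rewrite /= Rmult_1_r.
apply: (is_series_incr_1 (fun m => PS_Int a m * s ^ m)).
rewrite /plus /= Rmult_0_l Rplus_0_r; exact: ln_series.
Qed.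

(** * The function G and its analyticity *)

Section DotProduct.

Variable n : nat.
Implicit Types u v : vec n.

Lemma dotvC u v : dotv u v = dotv v u.
Proof. by apply: eq_bigr => i _; exact: Rmult_comm. Qed.

Lemma dotvZl c u v : dotv (fun i => c * u i) v = c * dotv u v.
Proof. by rewrite /dotv sumR_distrr; apply: eq_bigr => i _; ring. Qed.

Lemma dotvBl u u' v : dotv (fun i => u i - u' i) v = dotv u v - dotv u' v.
Proof.
have -> : dotv u v - dotv u' v = dotv u v + -1 * dotv u' v by ring.
rewrite -dotvZl /dotv -big_split; apply: eq_bigr => i _ /=; ring.
Qed.

Lemma dotvv_ge0 u : 0 <= dotv u u.
Proof. by apply: sumR_ge0 => i _; exact: Rle_0_sqr. Qed.

Lemma dotvv_eq0 u i : dotv u u = 0 -> u i = 0.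
Proof.
rewrite /dotv (bigD1 i) // => E.
have E' : u i * u i + \big[Rplus/0]_(j < n | j != i) (u j * u j) = 0 := E.
have : 0 <= \big[Rplus/0]_(j < n | j != i) (u j * u j).
  by apply: sumR_ge0 => j _; exact: Rle_0_sqr.
by move=> ?; apply: Rsqr_0_uniq; have := Rle_0_sqr (u i); rewrite /Rsqr; lra.
Qed.

Lemma is_derive_sum (I : Type) (s : seq I) (F : R -> I -> R) (F' : I -> R) y :
  (forall i, is_derive (fun z => F z i) y (F' i)) ->
  is_derive (fun z => \big[Rplus/0]_(i <- s) F z i) y (\big[Rplus/0]_(i <- s) F' i).
Proof.
move=> HF; elim: s => [|i s IH].
  rewrite big_nil; apply: (is_derive_ext (fun _ => 0)); last exact: is_derive_const.
  by move=> t; rewrite big_nil.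
rewrite big_cons; apply: (is_derive_ext (fun z => F z i + \big[Rplus/0]_(i <- s) F z i)).
  by move=> t; rewrite big_cons.
exact: is_derive_plus.
Qed.

Lemma is_derive_dotv (u : R -> vec n) u' v y :
  (forall i, is_derive (fun z => u z i) y (u' i)) ->
  is_derive (fun z => dotv (u z) v) y (dotv u' v).
Proof.
move=> Hu; apply: is_derive_sum => i.
have := is_derive_scal_l _ _ _ (v i) (Hu i); exact.
Qed.

Lemma analytic_at_dotv (T : finType) p (F G : 'I_n -> (T -> R) -> R) :
  (forall i, analytic_at p (F i)) -> (forall i, analytic_at p (G i)) ->
  analytic_at p (fun x => dotv (fun i => F i x) (fun i => G i x)).
Proof.
move=> HF HG; rewrite /dotv; elim: (index_enum _) => [|i s IH].
  have -> : (fun x : T -> R => \big[Rplus/0]_(i <- [::]) (F i x * G i x)) = fun _ => 0.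
    by apply: functional_extensionality => x; rewrite big_nil.
  exact: analytic_at_const.
have -> : (fun x : T -> R => \big[Rplus/0]_(i <- i :: s) (F i x * G i x)) =
    fun x => F i x * G i x + \big[Rplus/0]_(i <- s) (F i x * G i x).
  by apply: functional_extensionality => x; rewrite big_cons.
by apply: analytic_atD => //; exact: analytic_atM.
Qed.

End DotProduct.

(** * The total Riemann integral *)

Lemma Rint_unique f a b v : is_RInt f a b v -> Rint f a b = v.
Proof.
move=> fv; have ex : exists I, exists pr : Riemann_integrable f a b, RiemannInt pr = I.
  have pr : Riemann_integrable f a b by apply: ex_RInt_Reals_0; exists v.
  by exists (RiemannInt pr), pr.
(* Integrability makes the chosen value a genuine [RiemannInt], which agrees with [RInt] for
   whichever proof [pr] is chosen. *)
have [pr E] := epsilon_spec (inhabits 0) _ ex.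
by rewrite /Rint -E -RInt_Reals; exact: is_RInt_unique.
Qed.

Lemma Rint_FTC F f a b : (forall y, is_derive F y (f y)) -> (forall y, ex_derive f y) ->
  Rint f a b = F b - F a.
Proof.
move=> HF Hf; apply: Rint_unique; apply: is_RInt_derive => y _ //.
exact: ex_derive_continuous.
Qed.

(* At [t = 1] the quotient [x / 0] is a junk value, harmless because the
   formula is only ever multiplied by [1 - t] there. *)
Definition gfactor (alpha t : R) : R := (exp (- (alpha / 2) * ln t) - 1) * / (2 * (1 - t)).

(** For [|a|] outside 0 and 1, [gfactor alpha (dotv a a)] is [(1 - |a|^alpha) / (2 |a|^alpha (1 -
    |a|^2))]. Written in [|a|^2], a polynomial, it involves no square root. *)
Definition G2 n (alpha : R) (a b c d e : vec n) : vec n :=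
  fun i => gfactor alpha (dotv a a) * dotv c d * Pperp b e i.

Lemma gfactorE alpha t : gfactor alpha t * (2 - 2 * t) = exp (- (alpha / 2) * ln t) - 1.
Proof.
rewrite /gfactor; case: (Req_dec t 1) => [->|t1]; last by field; lra.
by rewrite ln_1 Rmult_0_r exp_0; ring.
Qed.

Lemma analytic_at_eq (T : finType) (p : T -> R) F G : (forall x, F x = G x) ->
  analytic_at p F -> analytic_at p G.
Proof. by move=> /functional_extensionality ->. Qed.

Lemma G2_analytic n alpha : G_analytic (@G2 n alpha).
Proof.
move=> i; apply: analytic_atP => p [p0 p1].
have An_sq : analytic_at p (fun z => dotv (blk z o5_0) (blk z o5_0)).
  by apply: analytic_at_dotv => j; exact: analytic_at_coord.
(* The two conditions of [G_domain] place the base point where [ln] and the reciprocal of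
   [2 (1 - |a|^2)] are analytic. *)
have t0 : 0 < dotv (blk p o5_0) (blk p o5_0).
  case: (dotvv_ge0 (blk p o5_0)) => // E; case: p0.
  by rewrite /normv -E sqrt_0.
have t1 : dotv (blk p o5_0) (blk p o5_0) <> 1.
  by move=> E; case: p1; rewrite /normv E sqrt_1.
apply: analytic_atM; first apply: analytic_atM.
- apply: analytic_atM.
    apply: analytic_atD; last exact: analytic_at_const.
    apply: (@analytic_at_comp _ _ (fun z => - (alpha / 2) * ln (dotv (blk z o5_0) (blk z o5_0))) exp);
      last exact: uanalytic_exp.
    apply: analytic_atM; first exact: analytic_at_const.
    by apply: (@analytic_at_comp _ _ (fun z => dotv (blk z o5_0) (blk z o5_0)) ln An_sq);
      exact: uanalytic_ln.
  apply: (@analytic_at_comp _ _ (fun z => 2 * (1 - dotv (blk z o5_0) (blk z o5_0))) Rinv).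
    apply: analytic_atM; first exact: analytic_at_const.
    apply: analytic_atD; first exact: analytic_at_const.
    apply: (@analytic_at_eq _ _ (fun z => -1 * dotv (blk z o5_0) (blk z o5_0))).
      by move=> z; ring.
    by apply: analytic_atM => //; exact: analytic_at_const.
  by apply: uanalytic_Rinv; lra.
- by apply: analytic_at_dotv => j; exact: analytic_at_coord.
- apply: analytic_atD; first exact: analytic_at_coord.
  apply: (@analytic_at_eq _ _ (fun z => -1 * (dotv (blk z o5_4) (blk z o5_1) * z (o5_1, i)))).
    by move=> z; rewrite /blk; ring.
  apply: analytic_atM; first exact: analytic_at_const.
  apply: analytic_atM; last exact: analytic_at_coord.
  by apply: analytic_at_dotv => j; exact: analytic_at_coord.
Qed.

(** * The integral identity *)

(** Uniqueness of derivatives identifies the sequence hidden in [smooth] with [f1] and [f2]; its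
    next member differentiates [f2]. *)
Lemma smooth_ex_derive2 f f1 f2 : smooth f ->
  (forall y, derivable_pt_lim f y (f1 y)) -> (forall y, derivable_pt_lim f1 y (f2 y)) ->
  forall y, ex_derive f2 y.
Proof.
move=> [D [D0 HD]] H1 H2.
have E1 : D 1%N = f1.
  apply: functional_extensionality => y; apply: uniqueness_limite (H1 y).
  by rewrite -D0; exact: HD.
have E2 : D 2%N = f2.
  apply: functional_extensionality => y; apply: uniqueness_limite (H2 y).
  by rewrite -E1; exact: HD.
by move=> y; exists (D 3%N y); rewrite -E2; apply/is_derive_Reals; exact: HD.
Qed.

Lemma is_derive_affine f f' a b y : (forall z, is_derive f z (f' z)) ->
  is_derive (fun z => f (a + z * b)) y (b * f' (a + y * b)).
Proof.
move=> Hf; apply: (is_derive_comp f (fun z => a + z * b)) => //.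
by auto_derive => //; ring.
Qed.

Lemma ex_derive_affine (f : R -> R) a b y : (forall z, ex_derive f z) ->
  ex_derive (fun z => f (a + z * b)) y.
Proof.
by move=> Hf; eexists; apply: (is_derive_affine (f' := Derive f)) => z; exact: Derive_correct.
Qed.

Lemma ex_derive_dotv n (u : R -> vec n) v y :
  (forall i, ex_derive (fun z => u z i) y) -> ex_derive (fun z => dotv (u z) v) y.
Proof.
move=> Hu; exists (dotv (fun i => Derive (fun z => u z i) y) v).
by apply: is_derive_dotv => i; exact: Derive_correct.
Qed.

Lemma periodic_IZR (f : R -> R) : (forall y, f (y + 1) = f y) ->
  forall k y, f (y + IZR k) = f y.
Proof.
move=> f1; have fN m y : f (y + INR m) = f y.
  by elim: m y => [|m IH] y; rewrite ?Rplus_0_r // S_INR -Rplus_assoc f1.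
move=> [|k|k] y; first by rewrite Rplus_0_r.
  by rewrite -Znat.positive_nat_Z -INR_IZR_INZ.
rewrite -Pos2Z.opp_pos opp_IZR -Znat.positive_nat_Z -INR_IZR_INZ.
by rewrite -(fN (Pos.to_nat k) (y + - _)); congr f; ring.
Qed.

Lemma is_derive_val (f : R -> R) y (l l' : R) : is_derive f y l -> l = l' -> is_derive f y l'.
Proof. by move=> H <-. Qed.

(** Shape of the antiderivatives in the two outer integrals of [nested_integral]. *)
Lemma is_derive_lin c e (f : R -> R) y (l : R) : is_derive f y l ->
  is_derive (fun z => c * (2 * z - e * f z)) y (c * (2 - e * l)).
Proof.
move=> D; auto_derive; first by exists l.
by rewrite (is_derive_unique _ _ _ D); ring.
Qed.

Lemma ex_derive_lin c (f : R -> R) y : ex_derive f y -> ex_derive (fun z => c * (2 - 2 * f z)) y.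
Proof. by move=> D; auto_derive. Qed.

Lemma ex_derive_sqr_shift (f : R -> R) x c w : ex_derive f (x + w) ->
  ex_derive (fun z => Rsqr (f (x + z) - c)) w.
Proof. by move=> D; rewrite /Rsqr; auto_derive. Qed.

(** * The curve, its chords and the two sides of the identity *)

Section Curve.

Variables (n : nat) (alpha : R) (g gd gdd : R -> vec n).
Hypothesis g_smooth : forall i : 'I_n, smooth (fun y => g y i).
Hypothesis g_per : forall (y : R) (i : 'I_n), g (y + 1) i = g y i.
Hypothesis g_simple : forall s t : R, 0 <= s < 1 -> 0 <= t < 1 ->
  (forall i : 'I_n, g s i = g t i) -> s = t.
Hypothesis g_der : forall (y : R) (i : 'I_n), derivable_pt_lim (fun u => g u i) y (gd y i).
Hypothesis gd_der : forall (y : R) (i : 'I_n), derivable_pt_lim (fun u => gd u i) y (gdd y i).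
Hypothesis gd_unit : forall y : R, normv (gd y) = 1.

Let g_is_derive i y : is_derive (fun u => g u i) y (gd y i).
Proof. by apply/is_derive_Reals; exact: g_der. Qed.

Let gd_is_derive i y : is_derive (fun u => gd u i) y (gdd y i).
Proof. by apply/is_derive_Reals; exact: gd_der. Qed.

Let gdd_ex_derive i y : ex_derive (fun u => gdd u i) y.
Proof. exact: (smooth_ex_derive2 (g_smooth i) (g_der^~ i) (gd_der^~ i)). Qed.

Let gd_ex_derive i y : ex_derive (fun u => gd u i) y.
Proof. by exists (gdd y i). Qed.

Lemma dotv_gd y : dotv (gd y) (gd y) = 1.
Proof.
by rewrite -(sqrt_sqrt _ (dotvv_ge0 (gd y))) -/(normv (gd y)) gd_unit Rmult_1_r.
Qed.

(** By periodicity both points may be moved to their fractional parts; simplicity makes these equal,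
    so [w] would be an integer with [0 < |w| < 1]. *)
Lemma g_inj x w : 0 < Rabs w < 1 -> exists i, g (x + w) i <> g x i.
Proof.
move=> w01; apply: NNPP => N.
have E i : g (x + w) i = g x i by apply: NNPP => Ei; apply: N; exists i.
have [a0 a1] := base_fp (x + w); have [b0 b1] := base_fp x.
have fr y i : g (frac_part y) i = g y i.
  rewrite -[in RHS](periodic_IZR (fun z => g_per z i) (- Int_part y)) opp_IZR.
  by congr (g _ i); rewrite /frac_part; ring.
have := g_simple (conj (Rge_le _ _ a0) a1) (conj (Rge_le _ _ b0) b1).
move=> /(_ (fun i => etrans (fr _ i) (etrans (E i) (esym (fr _ i))))).
rewrite /frac_part => F.
have W : w = IZR (Int_part (x + w) - Int_part x) by rewrite minus_IZR; lra.
move: w01; rewrite W -abs_IZR => -[/lt_IZR c0 /lt_IZR c1]; Lia.lia.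
Qed.

(** The mean velocity between [x] and [x + w] in closed form, for nonzero [w]. *)
Definition chord x w : vec n := fun i => (g (x + w) i - g x i) * / w.

Lemma avg_velE x w : w <> 0 -> avg_vel gd x w = chord x w.
Proof.
move=> w0; apply: functional_extensionality => i; rewrite /avg_vel /chord.
rewrite (Rint_FTC (F := fun t => g (x + t * w) i * / w)).
- by rewrite Rmult_1_l Rmult_0_l Rplus_0_r; ring.
- move=> y; apply: is_derive_val (is_derive_scal_l _ _ _ (/ w) (is_derive_affine x w y (g_is_derive i))) _.
  by rewrite /scal /= /mult /=; field.
- by move=> y; apply: (ex_derive_affine (f := fun u => gd u i)).
Qed.

Lemma chord_dotv x w : w <> 0 ->
  dotv (fun j => g (x + w) j - g x j) (fun j => g (x + w) j - g x j) =
  w ^ 2 * dotv (chord x w) (chord x w).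
Proof.
move=> w0; have E : (fun j => g (x + w) j - g x j) = (fun j => w * chord x w j).
  by apply: functional_extensionality => j; rewrite /chord; field.
by rewrite E dotvZl dotvC dotvZl; ring.
Qed.

Lemma chord_gt0 x w : 0 < Rabs w < 1 -> 0 < dotv (chord x w) (chord x w).
Proof.
move=> w01; have [i gi] := g_inj x w01.
case: (dotvv_ge0 (chord x w)) => // /esym /(dotvv_eq0 i); rewrite /chord.
have w0 : / w <> 0 by apply: Rinv_neq_0_compat => E; move: w01; rewrite E Rabs_R0; lra.
by move=> /Rmult_integral [] // ?; case: gi; lra.
Qed.

(* One minus the squared chord as a four-fold integral:
   [1 - <u, v> = |u - v|^2 / 2] for unit tangents, and [u - v] is the integral
   of the curvature vector. *)
Lemma nested_integral (k : R) x w : w <> 0 ->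
  Rint (fun s2 => Rint (fun s1 => Rint (fun p2 => Rint (fun p1 =>
      (s1 - s2) ^ 2 *
      (k * dotv (gdd (x + s2 * w + (s1 - s2) * p1 * w))
                (gdd (x + s2 * w + (s1 - s2) * p2 * w)))) 0 1) 0 1) 0 1) 0 1 =
  k * / w ^ 2 * (2 - 2 * dotv (chord x w) (chord x w)).
Proof.
move=> w0.
pose dl s1 s2 : vec n := fun i => gd (x + s1 * w) i - gd (x + s2 * w) i.
have arg s1 s2 p : x + s2 * w + (s1 - s2) * p * w = x + s2 * w + p * ((s1 - s2) * w) by ring.
have dgd s1 s2 v p : is_derive (fun p => dotv (gd (x + s2 * w + p * ((s1 - s2) * w))) v) p
    ((s1 - s2) * w * dotv (gdd (x + s2 * w + p * ((s1 - s2) * w))) v).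
  by rewrite -dotvZl; apply: is_derive_dotv => i; exact: (is_derive_affine _ _ _ (gd_is_derive i)).
have dgdd s1 s2 v p : ex_derive (fun p => dotv (gdd (x + s2 * w + p * ((s1 - s2) * w))) v) p.
  by apply: ex_derive_dotv => i; apply: (ex_derive_affine (f := fun u => gdd u i)).
have ends s1 s2 v : dotv (gd (x + s2 * w + 1 * ((s1 - s2) * w))) v -
    dotv (gd (x + s2 * w + 0 * ((s1 - s2) * w))) v = dotv (dl s1 s2) v.
  by rewrite -dotvBl; congr dotv; apply: functional_extensionality => i; congr (gd _ i - gd _ i); ring.
(* Integrating [gdd] along the segment costs one factor [(s1 - s2) w]. The weight [(s1 - s2)^2]
   supplies it here and once more in [I2], so only [w] is ever divided by and [s1 = s2] is no
   special case. *)
have I1 s1 s2 p2 : Rint (fun p1 => (s1 - s2) ^ 2 *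
      (k * dotv (gdd (x + s2 * w + (s1 - s2) * p1 * w))
                (gdd (x + s2 * w + (s1 - s2) * p2 * w)))) 0 1 =
    k * (s1 - s2) * / w * dotv (gdd (x + s2 * w + p2 * ((s1 - s2) * w))) (dl s1 s2).
  rewrite arg; set v := gdd _.
  have -> : (fun p1 => (s1 - s2) ^ 2 * (k * dotv (gdd (x + s2 * w + (s1 - s2) * p1 * w)) v)) =
      (fun p1 => (s1 - s2) ^ 2 * (k * dotv (gdd (x + s2 * w + p1 * ((s1 - s2) * w))) v)).
    by apply: functional_extensionality => p1; rewrite arg.
  rewrite (Rint_FTC (F := fun p1 => k * (s1 - s2) * / w * dotv (gd (x + s2 * w + p1 * ((s1 - s2) * w))) v)).
  - by rewrite -Rmult_minus_distr_l ends dotvC.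
  - move=> y; apply: is_derive_val (is_derive_scal _ _ (k * (s1 - s2) * / w) _ (dgd s1 s2 v y)) _.
    by rewrite /scal /= /mult /=; field.
  - by move=> y; apply: ex_derive_scal; apply: ex_derive_scal.
(* What remains is [|dl s1 s2|^2], which is [2 - 2 <u, v>] for unit tangents [u], [v]. *)
have I2 s1 s2 : Rint (fun p2 =>
    k * (s1 - s2) * / w * dotv (gdd (x + s2 * w + p2 * ((s1 - s2) * w))) (dl s1 s2)) 0 1 =
    k * / w ^ 2 * (2 - 2 * dotv (gd (x + s1 * w)) (gd (x + s2 * w))).
  rewrite (Rint_FTC (F := fun p2 => k * / w ^ 2 * dotv (gd (x + s2 * w + p2 * ((s1 - s2) * w))) (dl s1 s2))).
  - rewrite -Rmult_minus_distr_l ends; congr (_ * _).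
    rewrite dotvBl !(dotvC _ (dl _ _)) !dotvBl !dotv_gd (dotvC (gd (x + s2 * w))); ring.
  - move=> y; apply: is_derive_val (is_derive_scal _ _ (k * / w ^ 2) _ (dgd s1 s2 (dl s1 s2) y)) _.
    by rewrite /scal /= /mult /=; field.
  - by move=> y; apply: ex_derive_scal.
(* Averaging the tangent over [s1] gives the chord; [I4] does the same over [s2]. *)
have I3 s2 : Rint (fun s1 => k * / w ^ 2 * (2 - 2 * dotv (gd (x + s1 * w)) (gd (x + s2 * w)))) 0 1 =
    k * / w ^ 2 * (2 - 2 * dotv (gd (x + s2 * w)) (chord x w)).
  rewrite (Rint_FTC (F := fun s1 => k * / w ^ 2 * (2 * s1 - 2 * / w * dotv (g (x + s1 * w)) (gd (x + s2 * w))))).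
  - rewrite -Rmult_minus_distr_l; congr (_ * _).
    have -> : chord x w = fun i => / w * (g (x + 1 * w) i - g (x + 0 * w) i).
      by apply: functional_extensionality => i; rewrite /chord Rmult_1_l Rmult_0_l Rplus_0_r; ring.
    rewrite (dotvC (gd (x + s2 * w))) dotvZl dotvBl; ring.
  - move=> y.
    have D : is_derive (fun s1 => dotv (g (x + s1 * w)) (gd (x + s2 * w))) y
        (w * dotv (gd (x + y * w)) (gd (x + s2 * w))).
      by rewrite -dotvZl; apply: is_derive_dotv => i; exact: (is_derive_affine _ _ _ (g_is_derive i)).
    by apply: is_derive_val (is_derive_lin _ _ D) _; field.
  - move=> y.
    have D : ex_derive (fun s1 => dotv (gd (x + s1 * w)) (gd (x + s2 * w))) y.
      by apply: ex_derive_dotv => i; apply: (ex_derive_affine (f := fun u => gd u i)).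
    exact: ex_derive_lin.
have I4 : Rint (fun s2 => k * / w ^ 2 * (2 - 2 * dotv (gd (x + s2 * w)) (chord x w))) 0 1 =
    k * / w ^ 2 * (2 - 2 * dotv (chord x w) (chord x w)).
  rewrite (Rint_FTC (F := fun s2 => k * / w ^ 2 * (2 * s2 - 2 * / w * dotv (g (x + s2 * w)) (chord x w)))).
  - rewrite -Rmult_minus_distr_l; congr (_ * _).
    have -> : dotv (chord x w) (chord x w) =
        / w * (dotv (g (x + 1 * w)) (chord x w) - dotv (g (x + 0 * w)) (chord x w)).
      rewrite -dotvBl -dotvZl; congr dotv; apply: functional_extensionality => i.
      by rewrite /chord Rmult_1_l Rmult_0_l Rplus_0_r; ring.
    ring.
  - move=> y.
    have D : is_derive (fun s2 => dotv (g (x + s2 * w)) (chord x w)) y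
        (w * dotv (gd (x + y * w)) (chord x w)).
      by rewrite -dotvZl; apply: is_derive_dotv => i; exact: (is_derive_affine _ _ _ (g_is_derive i)).
    by apply: is_derive_val (is_derive_lin _ _ D) _; field.
  - move=> y.
    have D : ex_derive (fun s2 => dotv (gd (x + s2 * w)) (chord x w)) y.
      by apply: ex_derive_dotv => i; apply: (ex_derive_affine (f := fun u => gd u i)).
    exact: ex_derive_lin.
rewrite -I4; congr Rint; apply: functional_extensionality => s2.
rewrite -I3; congr Rint; apply: functional_extensionality => s1.
rewrite -I2; congr Rint; apply: functional_extensionality => p2.
exact: I1.
Qed.

Definition energy_kernel x w : R :=
  / Rpower (normv (fun j => g (x + w) j - g x j)) alpha - / Rpower (Rabs w) alpha.

(** The distance is [|w|] times the length of the chord vector, so [|w|^-alpha] factors out of both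
    terms. *)
Lemma energy_kernelE x w : 0 < Rabs w < 1 ->
  energy_kernel x w =
  (exp (- (alpha / 2) * ln (dotv (chord x w) (chord x w))) - 1) * / Rpower (Rabs w) alpha.
Proof.
move=> w01; have t0 := chord_gt0 x w01; set t := dotv _ _ in t0 *.
have w0 : w <> 0 by move=> E; move: w01; rewrite E Rabs_R0; lra.
rewrite /energy_kernel /normv chord_dotv // sqrt_mult; [|exact: pow2_ge_0|exact: Rlt_le].
have -> : sqrt (w ^ 2) = Rabs w by rewrite -(sqrt_Rsqr_abs w) /Rsqr; congr sqrt; ring.
rewrite -/t -Rpower_mult_distr; [|lra|exact: sqrt_lt_R0].
rewrite -(Rpower_sqrt t) // Rpower_mult.
have -> : exp (- (alpha / 2) * ln t) = / Rpower t (/ 2 * alpha).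
  by rewrite -Rpower_Ropp /Rpower; congr exp; field.
field; split; apply: Rgt_not_eq; exact: exp_pos.
Qed.

(** Simplicity keeps the squared distance [N] positive, so root, logarithm and reciprocals are
    differentiable there. This supplies the integrability used in [R2_perp]. *)
Lemma energy_kernel_continuous x w : 0 < Rabs w < 1 -> continuous (energy_kernel x) w.
Proof.
move=> w01; have t0 := chord_gt0 x w01.
have w0 : w <> 0 by move=> E; move: w01; rewrite E Rabs_R0; lra.
pose N z := dotv (fun j => g (x + z) j - g x j) (fun j => g (x + z) j - g x j).
have N0 : 0 < N w by rewrite /N chord_dotv //; apply: Rmult_lt_0_compat => //; nra.
have DN : ex_derive N w.
  eexists; apply: (is_derive_sum _ (F' := fun i => Derive (fun z => Rsqr (g (x + z) i - g x i)) w)) => i.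
  apply: Derive_correct; apply: (ex_derive_sqr_shift (f := fun u => g u i)).
  by exists (gd (x + w) i).
apply: ex_derive_continuous; rewrite /energy_kernel /normv /Rpower.
apply: (ex_derive_ext (fun w => / exp (alpha * ln (sqrt (N w))) - / exp (alpha * ln (Rabs w)))) => //.
have S0 := sqrt_lt_R0 _ N0.
auto_derive; repeat split=> //; try (apply: Rgt_not_eq; exact: exp_pos); lra.
Qed.

Lemma RHS_integrand x w i : 0 < Rabs w < 1 ->
  Rint (fun s2 => Rint (fun s1 => Rint (fun p2 => Rint (fun p1 =>
      (s1 - s2) ^ 2 *
      G2 alpha (avg_vel gd x w) (gd x)
        (gdd (x + s2 * w + (s1 - s2) * p1 * w))
        (gdd (x + s2 * w + (s1 - s2) * p2 * w))
        (gdd x) i) 0 1) 0 1) 0 1) 0 1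
    / Rpower (Rabs w) (alpha - 2) = Pperp (gd x) (gdd x) i * energy_kernel x w.
Proof.
move=> w01; have w0 : w <> 0 by move=> E; move: w01; rewrite E Rabs_R0; lra.
rewrite avg_velE //; set a := chord x w.
have -> : Rint (fun s2 => Rint (fun s1 => Rint (fun p2 => Rint (fun p1 =>
      (s1 - s2) ^ 2 *
      G2 alpha a (gd x)
        (gdd (x + s2 * w + (s1 - s2) * p1 * w))
        (gdd (x + s2 * w + (s1 - s2) * p2 * w))
        (gdd x) i) 0 1) 0 1) 0 1) 0 1 =
   gfactor alpha (dotv a a) * Pperp (gd x) (gdd x) i * / w ^ 2 * (2 - 2 * dotv a a).
  (* The factor [g(a)] and the projected vector do not depend on the four inner variables, and form
     the constant [k]. *)
  rewrite -nested_integral //.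
  do 4 (congr Rint; apply: functional_extensionality => ?).
  by rewrite /G2; ring.
have -> : gfactor alpha (dotv a a) * Pperp (gd x) (gdd x) i * / w ^ 2 * (2 - 2 * dotv a a) =
    gfactor alpha (dotv a a) * (2 - 2 * dotv a a) * Pperp (gd x) (gdd x) i * / w ^ 2 by ring.
rewrite gfactorE energy_kernelE // -/a.
(* The [1 / w^2] left by the inner integrals turns the weight [|w|^(2 - alpha)] into
   [|w|^-alpha]. *)
have -> : Rpower (Rabs w) alpha = Rpower (Rabs w) (alpha - 2) * w ^ 2.
  have -> : w ^ 2 = Rpower (Rabs w) (INR 2).
    by rewrite Rpower_pow ?pow2_abs //; lra.
  by rewrite -Rpower_plus; congr Rpower; rewrite /=; ring.
by field; split=> //; apply: Rgt_not_eq; exact: exp_pos.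
Qed.

(** Both sides are the projection of [gdd x] times the integral [S] of the kernel: on the left
    because [R2] is [S] times [gdd x] and projection is linear, on the right pointwise in [w]. *)
Lemma R2_perp eps x i : 0 < eps <= 1 / 2 ->
  Pperp (gd x) (R2 alpha eps g gdd x) i = RHS6p1 alpha eps (@G2 n alpha) gd gdd x i.
Proof.
move=> e0.
have ann a b : 0 < a <= b /\ b < 1 \/ -1 < a <= b /\ b < 0 -> 
    (forall w, a <= w <= b -> 0 < Rabs w < 1).
  move=> ab w wab; split; first by apply: Rabs_pos_lt; lra.
  by apply: Rabs_def1; lra.
have ab1 : 0 < eps <= 1 / 2 /\ 1 / 2 < 1 \/ -1 < eps <= 1 / 2 /\ 1 / 2 < 0 by lra.
have ab2 : 0 < - (1 / 2) <= - eps /\ - eps < 1 \/ -1 < - (1 / 2) <= - eps /\ - eps < 0 by lra.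
have int a b : 0 < a <= b /\ b < 1 \/ -1 < a <= b /\ b < 0 ->
    is_RInt (energy_kernel x) a b (RInt (energy_kernel x) a b).
  move=> ab; apply: RInt_correct; apply: ex_RInt_continuous => w.
  rewrite Rmin_left ?Rmax_right; try lra.
  by move=> wab; apply: energy_kernel_continuous; exact: ann wab.
pose S := RInt (energy_kernel x) (- (1 / 2)) (- eps) + RInt (energy_kernel x) eps (1 / 2).
(* Both halves of the annulus lie in [0 < |w| < 1], so an integrand matching a multiple of the
   kernel there has that multiple of [S] as integral. *)
have sc f c : (forall w, 0 < Rabs w < 1 -> f w = c * energy_kernel x w) ->
    Rint_ann f eps = c * S.
  move=> Hf; rewrite /Rint_ann /S Rmult_plus_distr_l.
  have one a b : 0 < a <= b /\ b < 1 \/ -1 < a <= b /\ b < 0 ->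
      Rint f a b = c * RInt (energy_kernel x) a b.
    move=> ab; apply: Rint_unique.
    apply: (is_RInt_ext (fun w => scal c (energy_kernel x w))); last exact: is_RInt_scal (int _ _ ab).
    move=> w; rewrite Rmin_left ?Rmax_right; try lra.
    by move=> wab; rewrite Hf //; apply: (ann _ _ ab); lra.
  by rewrite !one.
have -> : RHS6p1 alpha eps (@G2 n alpha) gd gdd x i = Pperp (gd x) (gdd x) i * S.
  by apply: sc => w; exact: RHS_integrand.
have -> : R2 alpha eps g gdd x = fun k => S * gdd x k.
  by apply: functional_extensionality => k; rewrite Rmult_comm; apply: sc.
rewrite /Pperp dotvZl; ring.
Qed.

End Curve.

Theorem theorem6p1 (n : nat) (alpha : R) :
  2 < alpha < 3 ->
  exists G : vec n -> vec n -> vec n -> vec n -> vec n -> vec n,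
    G_analytic G /\
    forall (eps : R) (g gd gdd : R -> vec n),
      0 < eps <= 1/2 ->
      (* gamma smooth, 1-periodic, simple, arc-length parametrized *)
      (forall i : 'I_n, smooth (fun y => g y i)) ->
      (forall (y : R) (i : 'I_n), g (y + 1) i = g y i) ->
      (forall s t : R, 0 <= s < 1 -> 0 <= t < 1 ->
         (forall i : 'I_n, g s i = g t i) -> s = t) ->
      (* gd, gdd are the first and second derivatives of gamma *)
      (forall (y : R) (i : 'I_n), derivable_pt_lim (fun u => g u i) y (gd y i)) ->
      (forall (y : R) (i : 'I_n), derivable_pt_lim (fun u => gd u i) y (gdd y i)) ->
      (forall y : R, normv (gd y) = 1) ->
      forall (x : R) (i : 'I_n),
        Pperp (gd x) (R2 alpha eps g gdd x) i = RHS6p1 alpha eps G gd gdd x i.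
Proof.
move=> _; exists (@G2 n alpha); split; first exact: G2_analytic.
by move=> eps g gd gdd e0 sm per simp d1 d2 un x i; apply: R2_perp.
Qed.
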